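(* Let $u$ be a quasi continuous function on $D$ (extended by $0$ outside $D$) and let $\rho\in\Theta_D$. Then $u\in\mathcal D^{1,c}_\rho(D)$ if and only if there exists an increasing convex function $\varphi:\mathbb R^+\to\mathbb R^+$ with $\varphi(0)=0$ and $\lim_{x\to\infty}\varphi(x)/x=\infty$ such that \[ \sup_{V\in\mathcal O_q(D)}\int_D P_V(\varphi(|u|))\,\rho\,dm<\infty . \]
   Context: Setting. $E$ is a locally compact separable metric space, $\partial$ its one-point compactification point (an isolated point if $E$ is compact), $m$ a nonnegative Radon measure on $E$ with full support, $(\mathcal E,\mathfrak D(\mathcal E))$ a symmetric, regular, transient Dirichlet form on $L^2(E;m)$. $(X_t,P_x)$ is the associated $m$-symmetric Hunt process on $E$ with cemetery $\partial$; $\mathbb E_x$ is the expectation under $P_x$. Functions are extended by $0$ to $\partial$. ''q.e.'' means outside an exceptional (zero capacity) set for $\mathcal E$. For nearly Borel $V\subset E$, $\tau_V=\inf\{t>0:X_t\notin V\}$. $D\subset E$ is a nonempty open set, and the process killed on leaving $D$ satisfies the absolute continuity condition (its resolvent kernels $R^D_\alpha(x,\cdot)$, $\alpha>0$, $x\in D$, are absolutely continuous with respect to $m$). Notation. $V\subset E$ is quasi open if for every $\varepsilon>0$ there is an open $G\supset V$ with $\mathrm{Cap}(G\setminus V)<\varepsilon$; $\mathcal O_q(D)$ is the family of quasi open nearly Borel subsets of $D$. For $g\ge0$, $P_V(g)(x)=\mathbb E_xg(X_{\tau_V})$. $\Theta_D$ is the set of strictly positive measurable $\rho:D\to\mathbb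 R$ with $\int_D\rho\,dm=1$. $\|u\|_{\mathcal D^1_\rho(D)}=\sup_{V\in\mathcal O_q(D)}\int_DP_V(|u|)\rho\,dm$, and $\mathcal D^1_\rho(D)$ is the set of nearly Borel functions $u$ on $E$ with $u=0$ q.e. on $E\setminus D$ and $\lim_{n\to\infty}\|(|u|-n)^+\|_{\mathcal D^1_\rho(D)}=0$. $\mathcal D^{1,c}_\rho(D)$ is the set of $u\in\mathcal D^1_\rho(D)$ that are quasi continuous on $D$. *)

(* Defs.v *)
From HB Require Import structures.
From mathcomp Require Export all_boot all_order all_algebra.
From mathcomp Require Export all_classical all_reals all_analysis.
From mathcomp Require Export measurable_realfun.
Export Order.TTheory GRing.Theory Num.Theory.
Export numFieldNormedType.Exports.

Set Implicit Arguments.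
Unset Strict Implicit.
Unset Printing Implicit Defensive.

Local Open Scope classical_set_scope.
Local Open Scope ring_scope.

(* A base point is required by [measurableType]. *)
#[short(type="pmetricType")]
HB.structure Definition PointedMetric (R : numDomainType) :=
  {T of Pointed T & Metric R T}.

Definition separable (T : topologicalType) : Prop :=
  exists2 A : set T, countable A & dense A.

Notation borel T := (g_sigma_algebraType (@open T)).

(* Integral of a nonnegative function that need not be measurable for the
   sigma-algebra of [mu]: the infimum of the integrals of its measurable
   majorants. If [f] is measurable for the completion of [mu], this is the
   integral of [f] with respect to the completion, whereas the library has no
   integration with respect to the completion of a given measure. It is needed
   because exit times from nearly Borel sets, and the functions derived from
   them, are measurable only after completion. *)
Definition cintegral d (T : measurableType d) (R : realType)
    (mu : {measure set T -> \bar R}) (D : set T) (f : T -> \bar R) : \bar R :=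
  ereal_inf [set \int[mu]_(x in D) g x | g in
    [set g : T -> \bar R |
      measurable_fun D g /\ forall x, D x -> (f x <= g x)%E]]%E.

Section dirichlet.
Context {R : realType} {E : pmetricType R}.

Definition radon (m : {measure set (borel E) -> \bar R}) : Prop :=
  forall K : set E, compact K -> (m K < +oo)%E.

Definition full_support (m : {measure set (borel E) -> \bar R}) : Prop :=
  forall U : set E, open U -> U !=set0 -> (0 < m U)%E.

Context (m : {measure set (borel E) -> \bar R}).

Definition L2 : set (E -> R) := [set f | (f : borel E -> R) \in Lfun m 2%:E].

Definition inner2 (u v : E -> R) : R := \int[m]_x (u x * v x).

Definition ae_eq2 (u v : E -> R) : Prop :=
  {ae m, forall x : borel E, u x = v x}.

Definition form_plus (e : (E -> R) -> (E -> R) -> R) (alpha : R)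
  (u v : E -> R) : R := e u v + alpha * inner2 u v.

(* Elements of L^2(E; m) are represented by Borel functions; the domain and the
   form do not depend on the representative. *)
Record dirichlet_form := DirichletForm {
  dom : set (E -> R) ;
  form : (E -> R) -> (E -> R) -> R ;
  dom_L2 : dom `<=` L2 ;
  dom_ae : forall u v, dom u -> L2 v -> ae_eq2 u v -> dom v ;
  form_ae : forall u v w, dom u -> dom v -> dom w -> ae_eq2 u v ->
    form u w = form v w ;
  dom_lin : forall (a : R) u v, dom u -> dom v ->
    dom (fun x => a * u x + v x) ;
  form_lin : forall (a : R) u v w, dom u -> dom v -> dom w ->
    form (fun x => a * u x + v x) w = a * form u w + form v w ;
  form_sym : forall u v, dom u -> dom v -> form u v = form v u ;
  form_ge0 : forall u, dom u -> 0 <= form u u ;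
  dom_dense : forall f, L2 f -> forall e : R, 0 < e ->
    exists2 u, dom u & inner2 (f \- u) (f \- u) < e ;
  form_closed : forall u_ : nat -> E -> R, (forall n, dom (u_ n)) ->
    (forall e : R, 0 < e -> exists N, forall n k, (N <= n)%N -> (N <= k)%N ->
       form_plus form 1 (u_ n \- u_ k) (u_ n \- u_ k) < e) ->
    exists2 u, dom u &
      form_plus form 1 (u_ n \- u) (u_ n \- u) @[n --> \oo] --> (0 : R) ;
  form_markov : forall u, dom u ->
    let v := fun x => Num.min (Num.max (u x) 0) 1 in
    dom v /\ form v v <= form u u }.

Context (EE : dirichlet_form).

Definition Cc : set (E -> R) :=
  [set f | continuous f /\ compact (closure [set x | f x != 0])].

Definition regular_form : Prop :=
  (forall u, dom EE u -> forall e : R, 0 < e -> exists v,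
     [/\ dom EE v, Cc v &
         form_plus (form EE) 1 (u \- v) (u \- v) < e]) /\
  (forall f, Cc f -> forall e : R, 0 < e -> exists v,
     [/\ dom EE v, Cc v & forall x, `|f x - v x| < e]).

(* Transience is stated as the existence of a reference function, which is the
   definition for Dirichlet forms and is equivalent to the transience of the
   associated semigroup. *)
Definition transient_form : Prop :=
  exists g : borel E -> R,
    [/\ measurable_fun setT g, (exists M : R, forall x, `|g x| <= M),
        m.-integrable setT (EFin \o g), {ae m, forall x, 0 < g x} &
        forall u, dom EE u ->
          (\int[m]_x (`|u x| * g x)%:E <= (Num.sqrt (form EE u u))%:E)%E].

(* [capacity] is the 1-capacity, built from E_1 = E + (., .). *)
Definition open_capacity (G : set E) : \bar R :=
  ereal_inf [set (form_plus (form EE) 1 u u)%:E | u in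
    [set u | dom EE u /\ {ae m, forall x : borel E, G x -> 1 <= u x}]].

Definition capacity (A : set E) : \bar R :=
  ereal_inf [set open_capacity G | G in [set G | open G /\ A `<=` G]].

Definition quasi_everywhere (Q : E -> Prop) : Prop :=
  exists2 N, capacity N = 0%E & forall x, ~ N x -> Q x.

Definition quasi_open (V : set E) : Prop :=
  forall e : R, 0 < e -> exists G,
    [/\ open G, V `<=` G & (capacity (G `\` V) < e%:E)%E].

Definition quasi_continuous_on (D : set E) (u : E -> R) : Prop :=
  forall e : R, 0 < e -> exists G,
    [/\ open G, (capacity G < e%:E)%E & {within D `\` G, continuous u}].

End dirichlet.

(* The cemetery is the point [None] of the library's one-point
   compactification; that point is isolated when [E] is compact. *)
Notation cem E := (one_point_compactification E).

Definition ext0 (R : realType) (E : Type) (f : E -> R) (x : cem E) : R :=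
  if x is Some y then f y else 0.

(* Value of a traj at a possibly infinite time, with the convention that it is
   the cemetery at infinity. *)
Definition value_at (R : realType) (E : Type) (Omega : Type)
    (X : R -> Omega -> cem E) (t : \bar R) (w : Omega) : cem E :=
  if t is r%:E%E then X r w else None.

Definition stopping_time (R : realType) (Omega : Type)
    (F : R -> set (set Omega)) (s : Omega -> \bar R) : Prop :=
  (forall w, (0 <= s w)%E) /\
  (forall t : R, 0 <= t -> F t [set w | (s w <= t%:E)%E]).

Definition stopped_sigma_algebra d (R : realType) (Omega : measurableType d)
    (F : R -> set (set Omega)) (s : Omega -> \bar R) : set (set Omega) :=
  [set L | measurable L /\
    forall t : R, 0 <= t -> F t (L `&` [set w | (s w <= t%:E)%E])].

(* Time is [0, +oo[: the values of [traj], [time_shift] and [filtr] at negative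
   times are irrelevant. The strong Markov property and quasi-left continuity
   are stated for the laws P_x; integrating in x gives them for every initial
   distribution. *)
Record hunt_process (R : realType) (E : pmetricType R) d
    (Omega : measurableType d) := HuntProcess {
  traj : R -> Omega -> cem E ;
  law : R.-pker (borel (cem E)) ~> Omega ;
  time_shift : R -> Omega -> Omega ;
  filtr : R -> set (set Omega) ;
  traj_shift : forall s t w, 0 <= s -> 0 <= t ->
    traj s (time_shift t w) = traj (s + t) w ;
  filtr_sigma : forall t, 0 <= t -> sigma_algebra setT (filtr t) ;
  filtr_measurable : forall t, 0 <= t -> filtr t `<=` measurable ;
  filtr_incr : forall s t, 0 <= s -> s <= t -> filtr s `<=` filtr t ;
  filtr_right : forall t, 0 <= t ->
    \bigcap_(s in [set s | t < s]) filtr s `<=` filtr t ;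
  traj_adapted : forall t, 0 <= t -> forall B : set (borel (cem E)),
    measurable B -> filtr t (traj t @^-1` B) ;
  law_normal : forall x : cem E, law x [set w | traj 0 w = x] = 1%E ;
  traj_absorbed : forall s t w, 0 <= s -> s <= t ->
    traj s w = None -> traj t w = None ;
  traj_right : forall w t, 0 <= t ->
    traj s w @[s --> t^'+] --> traj t w ;
  traj_left : forall w t, 0 < t -> cvg (traj s w @[s --> t^'-]) ;
  strong_markov : forall s, stopping_time filtr s ->
    forall L, stopped_sigma_algebra filtr s L ->
    forall (x : cem E) (t : R) (B : set (borel (cem E))),
      0 <= t -> measurable B ->
      law x (L `&` [set w | B (value_at traj (s w + t%:E)%E w)]) =
      (\int[law x]_(w in L) law (value_at traj (s w) w) (traj t @^-1` B))%E ;
  quasi_left_continuous : forall s_ : nat -> Omega -> \bar R,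
    (forall n, stopping_time filtr (s_ n)) ->
    (forall w n, (s_ n w <= s_ n.+1 w)%E) ->
    let s w := ereal_sup (range (fun n => s_ n w)) in
    forall x : cem E, {ae law x, forall w, (s w < +oo)%E ->
      value_at traj (s_ n w) w @[n --> \oo] --> value_at traj (s w) w } }.

Section process.
Context {R : realType} {E : pmetricType R} {d : measure_display}
  {Omega : measurableType d} (X : hunt_process E Omega).

Definition resolvent (alpha : R) (f : E -> R) (x : E) : R :=
  \int[law X (Some x)]_w \int[lebesgue_measure]_(t in `[0, +oo[)
    (expR (- (alpha * t)) * ext0 f (traj X t w)).

Definition semigroup (t : R) (f : E -> R) (x : E) : R :=
  \int[law X (Some x)]_w ext0 f (traj X t w).

(* The L^2-resolvent G_alpha of the form is characterized by
   E_alpha(G_alpha f, v) = (f, v) for all v in the domain; the process is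
   associated with the form if its resolvent is a version of G_alpha. *)
Definition associated (m : {measure set (borel E) -> \bar R})
    (EE : dirichlet_form m) : Prop :=
  forall (alpha : R) (f : E -> R), 0 < alpha -> L2 m f ->
    (exists M : R, forall x, `|f x| <= M) ->
    dom EE (resolvent alpha f) /\
    forall v, dom EE v ->
      form_plus m (form EE) alpha (resolvent alpha f) v = inner2 m f v.

Definition symmetric_process (m : {measure set (borel E) -> \bar R}) : Prop :=
  forall (t : R) (f g : E -> R), 0 <= t -> L2 m f -> L2 m g ->
    (exists M : R, forall x, `|f x| <= M) ->
    (exists M : R, forall x, `|g x| <= M) ->
    inner2 m (semigroup t f) g = inner2 m f (semigroup t g).

Definition exit_time (V : set E) (w : Omega) : \bar R :=
  ereal_inf [set t%:E | t in [set t | 0 < t /\ ~ (Some @` V) (traj X t w)]].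

(* Subsets of E are seen as subsets of the space with the cemetery adjoined; the
   last condition is P_mu(X_t in B2 \ B1 for some t >= 0) = 0. *)
Definition nearly_borel (A : set E) : Prop :=
  forall mu : probability (borel (cem E)) R,
  exists B1 B2 : set (borel (cem E)),
    [/\ measurable B1, measurable B2, B1 `<=` Some @` A, Some @` A `<=` B2 &
      exists N : set Omega,
        [/\ measurable N, (\int[mu]_x law X x N = 0)%E &
          [set w | exists2 t, 0 <= t & (B2 `\` B1) (traj X t w)] `<=` N]].

Definition nearly_borel_fun (u : E -> R) : Prop :=
  forall C : set R, measurable C -> nearly_borel (u @^-1` C).

Definition killed_resolvent (D : set E) (alpha : R) (x : E) (B : set E) :
    \bar R :=
  cintegral (law X (Some x)) setT (fun w =>
    \int[lebesgue_measure]_(t in [set t : R | (0 <= t)%R /\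
                                         (t%:E < exit_time D w)%E])
      (expR (- (alpha * t)) * \1_(Some @` B) (traj X t w))%:E)%E.

Definition killed_absolutely_continuous
    (m : {measure set (borel E) -> \bar R}) (D : set E) : Prop :=
  forall (alpha : R) (x : E), 0 < alpha -> D x ->
  forall B : set (borel E), measurable B -> m B = 0%E ->
    killed_resolvent D alpha x B = 0%E.

(* P_V(g)(x) = E_x g(X_{tau_V}) for g >= 0 *)
Definition exit_op (V : set E) (g : E -> R) (x : E) : \bar R :=
  cintegral (law X (Some x)) setT
    (fun w => (ext0 g (value_at (traj X) (exit_time V w) w))%:E).

Context {m : {measure set (borel E) -> \bar R}} (EE : dirichlet_form m).

Definition Oq (D : set E) : set (set E) :=
  [set V | [/\ V `<=` D, quasi_open EE V & nearly_borel V]].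

Definition sup_exit (D : set E) (rho : E -> R) (g : E -> R) : \bar R :=
  ereal_sup [set cintegral m D (fun x => exit_op V g x * (rho x)%:E)%E |
              V in Oq D].

Definition D1_norm (D : set E) (rho : E -> R) (u : E -> R) : \bar R :=
  sup_exit D rho (fun x => `|u x|).

Definition D1 (D : set E) (rho : E -> R) : set (E -> R) :=
  [set u | [/\ nearly_borel_fun u,
      quasi_everywhere EE (fun x => ~ D x -> u x = 0) &
      D1_norm D rho (fun x => Num.max (`|u x| - n%:R) 0) @[n --> \oo]
        --> 0%E]].

Definition D1c (D : set E) (rho : E -> R) : set (E -> R) :=
  [set u | D1 D rho u /\ quasi_continuous_on EE D u].

End process.

(* The values of a weight outside D are irrelevant. *)
Definition Theta (R : realType) (E : pmetricType R)
    (m : {measure set (borel E) -> \bar R}) (D : set E) : set (E -> R) :=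
  [set rho | [/\ measurable_fun (D : set (borel E)) (rho : borel E -> R),
      (forall x, D x -> 0 < rho x) &
      (\int[m]_(x in D) (rho x)%:E = 1)%E]].

(* Main.v *)
Require Import Defs.
From mathcomp Require Import ring lra.

(* This is de la Vallee-Poussin's argument for the sublinear functional
   [sup_exit], the supremum over V of the integrals of P_V(g) rho.  If
   ||(|u| - n)^+|| tends to 0, choose a_k >= k with
   ||(|u| - a_k)^+|| <= 2^-(k+1) and take phi x = sum_k (x - a_k)^+; countable
   subadditivity bounds the functional at phi(|u|) by 1.  Conversely,
   (|u| - n)^+ <= phi(|u|) / M as soon as phi x >= M x for all x >= n.  All
   integrals are upper integrals, for which countable subadditivity and
   homogeneity hold without any measurability of the integrands. *)

Set Implicit Arguments.
Unset Strict Implicit.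
Unset Printing Implicit Defensive.

Local Open Scope classical_set_scope.
Local Open Scope ring_scope.

(** * Upper integrals *)

Section cintegral.
Context d (T : measurableType d) (R : realType).
Context (mu : {measure set T -> \bar R}) (D : set T).
Local Open Scope ereal_scope.
Implicit Types f g : T -> \bar R.

Lemma cintegral_ge0 f : (forall x, D x -> 0 <= f x) -> 0 <= cintegral mu D f.
Proof.
move=> f0; apply: le_ereal_inf_tmp => _ [g [mg fg] <-].
by apply: integral_ge0 => x Dx; rewrite (le_trans (f0 _ Dx))// fg.
Qed.

Lemma le_cintegral f g : (forall x, D x -> f x <= g x) ->
  cintegral mu D f <= cintegral mu D g.
Proof.
move=> fg; apply: le_ereal_inf_tmp => _ [h [mh gh] <-]; apply: ereal_inf_lbound.
by exists h => //; split => // x Dx; rewrite (le_trans (fg _ Dx))// gh.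
Qed.

Hypothesis mD : measurable D.

Lemma cintegralZl_le (k : R) f : (0 < k)%R -> (forall x, D x -> 0 <= f x) ->
  cintegral mu D (fun x => k%:E * f x) <= k%:E * cintegral mu D f.
Proof.
move=> k0 f0; rewrite muleC -lee_pdivrMr//.
apply: le_ereal_inf_tmp => _ [g [mg fg] <-].
rewrite lee_pdivrMr// muleC -ge0_integralZl//; last 2 first.
- by move=> x Dx; rewrite (le_trans (f0 _ Dx))// fg.
- by rewrite lee_fin ltW.
apply: ereal_inf_lbound; exists (fun x => k%:E * g x) => //; split.
  exact: measurable_funeM.
by move=> x Dx; rewrite lee_pmul2l// ?fg.
Qed.

(** Choose measurable majorants [g k] whose integrals exceed the upper integrals by at most
    [e / 2 ^ k.+1]. Their sum is a measurable majorant of the series, integrated termwise by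
    monotone convergence. *)
Lemma cintegral_nneseries_le (f : nat -> T -> \bar R) :
  (forall k x, D x -> 0 <= f k x) ->
  cintegral mu D (fun x => \sum_(k <oo) f k x) <=
  \sum_(k <oo) cintegral mu D (f k).
Proof.
move=> f0; have I0 k : 0 <= cintegral mu D (f k) by exact: cintegral_ge0 (f0 k).
(* One infinite upper integral makes the right-hand side [+oo]; otherwise each infimum is finite and
   can be approximated. *)
have [Ioo|/existsNP[k /negP/negPn/eqP Ik]] :=
    pselect (forall k, cintegral mu D (f k) != +oo); last first.
  rewrite (@eseries_pinfty _ _ _ k) ?leey// => n _.
  by rewrite gt_eqF// (lt_le_trans _ (I0 n)).
have Ifin k : cintegral mu D (f k) \is a fin_num.
  by rewrite ge0_fin_numE// ltey.
apply/lee_addgt0Pr => e e0.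
have /choice[g gP] k : exists g : T -> \bar R,
    [/\ measurable_fun D g, (forall x, D x -> f k x <= g x) &
      \int[mu]_(x in D) g x <=
        cintegral mu D (f k) + (e / (2 ^ k.+1)%:R)%:E].
  have ek : (0 < e / (2 ^ k.+1)%:R)%R.
    by rewrite divr_gt0// ltr0n expn_gt0.
  have [_ [g [mg fg] <-] /ltW gk] := lb_ereal_inf_adherent ek (Ifin k).
  by exists g.
have g0 k x : D x -> 0 <= g k x.
  by move=> Dx; have [_ fg _] := gP k; rewrite (le_trans (f0 k _ Dx))// fg.
have mg k : measurable_fun D (g k) by have [] := gP k.
apply: (le_trans _ (epsilon_trick xpredT I0 (ltW e0))).
apply: (@le_trans _ _ (\sum_(k <oo) \int[mu]_(x in D) g k x)).
  rewrite -integral_nneseries//; apply: ereal_inf_lbound.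
  exists (fun x => \sum_(k <oo) g k x) => //; split.
    by apply: (@ge0_emeasurable_sum _ _ _ _ _ xpredT) => // k x Dx _; exact: g0.
  move=> x Dx; apply: lee_nneseries => k _; first by move=> _; exact: f0.
  by have [_ ->] := gP k.
apply: lee_nneseries => k _; last by have [] := gP k.
by move=> _; apply: integral_ge0 => x Dx; exact: g0.
Qed.

End cintegral.

(** * The exit operators *)

Section exit.
Context {R : realType} {E : pmetricType R} {d : measure_display}
  {Omega : measurableType d} (X : hunt_process E Omega).
Context {m : {measure set (borel E) -> \bar R}} (EE : dirichlet_form m).
Local Open Scope ereal_scope.
Implicit Types (V : set E) (g : E -> R).

Lemma exit_op_ge0 V g x : (forall y, 0 <= g y)%R -> 0 <= exit_op X V g x.
Proof.
by move=> g0; apply: cintegral_ge0 => w _; rewrite lee_fin; case: value_at => /=.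
Qed.

Lemma le_exit_op V g h x : (forall y, g y <= h y)%R ->
  exit_op X V g x <= exit_op X V h x.
Proof.
by move=> gh; apply: le_cintegral => w _; rewrite lee_fin; case: value_at => /=.
Qed.

Lemma exit_opZl_le V (k : R) g x : (0 < k)%R -> (forall y, 0 <= g y)%R ->
  exit_op X V (fun y => k * g y)%R x <= k%:E * exit_op X V g x.
Proof.
move=> k0 g0; rewrite /exit_op; apply: (le_trans _ (cintegralZl_le _ measurableT k0 _)).
- by apply: le_cintegral => w _; case: value_at => //=; rewrite mule0.
- by move=> w _; rewrite lee_fin; case: value_at => /=.
Qed.

(** The pointwise series identity survives extension to the cemetery, where [ext0] makes every term
    0. *)
Lemma exit_op_nneseries_le V g (g_ : nat -> E -> R) x :
    (forall k y, 0 <= g_ k y)%R ->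
    (forall y, (g y)%:E = \sum_(k <oo) (g_ k y)%:E) ->
  exit_op X V g x <= \sum_(k <oo) exit_op X V (g_ k) x.
Proof.
move=> g0 gE; rewrite /exit_op; apply: (le_trans _ (cintegral_nneseries_le _ measurableT _)).
- apply: le_cintegral => w _; case: value_at => [y|] /=; first by rewrite gE.
  by rewrite eseries0.
- by move=> k w _; rewrite lee_fin; case: value_at => /=.
Qed.

(** * The supremum over quasi open sets *)

Context (D : set E) (D_open : open D) (rho : E -> R).
Hypothesis rho0 : forall x, D x -> (0 < rho x)%R.

Let mD : measurable (D : set (borel E)).
Proof. exact: sub_sigma_algebra. Qed.

Lemma le_sup_exit g h : (forall y, g y <= h y)%R ->
  sup_exit X EE D rho g <= sup_exit X EE D rho h.
Proof.
move=> gh; apply: ge_ereal_sup => _ [V VD <-].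
apply: le_trans (ereal_sup_ubound _); last by exists V.
apply: le_cintegral => x Dx; rewrite lee_pmul2r// ?lte_fin ?rho0//.
exact: le_exit_op.
Qed.

Lemma sup_exitZl_le (k : R) g : (0 < k)%R -> (forall y, 0 <= g y)%R ->
  sup_exit X EE D rho (fun y => k * g y)%R <= k%:E * sup_exit X EE D rho g.
Proof.
move=> k0 g0; apply: ge_ereal_sup => _ [V VD <-].
apply: (@le_trans _ _
    (k%:E * cintegral m D (fun x => exit_op X V g x * (rho x)%:E))).
  apply: le_trans (cintegralZl_le _ mD k0 _) => //.
    apply: le_cintegral => x Dx; rewrite muleA lee_pmul2r// ?lte_fin ?rho0//.
    exact: exit_opZl_le.
  move=> x Dx; rewrite mule_ge0//; first exact: exit_op_ge0.
  by rewrite lee_fin ltW// rho0.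
by rewrite lee_pmul2l//; apply: ereal_sup_ubound; exists V.
Qed.

(** Subadditivity passes through both nested upper integrals, over paths and then over [D]; a
    supremum of sums is at most the sum of the suprema. *)
Lemma sup_exit_nneseries_le g (g_ : nat -> E -> R) :
    (forall k y, 0 <= g_ k y)%R ->
    (forall y, (g y)%:E = \sum_(k <oo) (g_ k y)%:E) ->
  sup_exit X EE D rho g <= \sum_(k <oo) sup_exit X EE D rho (g_ k).
Proof.
move=> g0 gE; apply: ge_ereal_sup => _ [V VD <-].
have t0 k x : D x -> 0 <= exit_op X V (g_ k) x * (rho x)%:E.
  by move=> Dx; rewrite mule_ge0 ?exit_op_ge0// lee_fin ltW// rho0.
apply: (@le_trans _ _ (\sum_(k <oo)
    cintegral m D (fun x => exit_op X V (g_ k) x * (rho x)%:E))).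
  apply: le_trans (cintegral_nneseries_le _ mD t0).
  apply: le_cintegral => x Dx.
  under eq_eseriesr do rewrite muleC.
  rewrite nneseriesZl; last by move=> k _; exact: exit_op_ge0.
  rewrite muleC lee_pmul2l// ?lte_fin ?rho0//.
  exact: exit_op_nneseries_le.
apply: lee_nneseries => k _; last by apply: ereal_sup_ubound; exists V.
by move=> _; apply: cintegral_ge0 => x Dx; exact: t0.
Qed.

(** Density provides some [u] in the domain, and linearity then gives [- u + u]. *)
Lemma dom0 : dom EE (fun=> 0%R).
Proof.
have L0 : L2 m (fun=> 0%R).
  rewrite /L2 /= inE/=; apply/andP; split; rewrite inE/=.
    exact: measurable_cst.
  rewrite /finite_norm (_ : EFin \o _ = cst 0); last by [].
  by rewrite Lnorm0.
have [u du _] := @dom_dense _ _ _ EE _ L0 1%R ltr01.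
have := dom_lin (-1)%R du du.
by congr (dom EE); apply/funext => x; rewrite mulN1r addNr.
Qed.

(** The zero function is admissible for the open set [set0] and has zero energy; no energy is
    negative. *)
Lemma capacity_set0 : capacity EE set0 = 0.
Proof.
have d0 := dom0; apply/eqP; rewrite eq_le; apply/andP; split.
  apply: (@le_trans _ _ (open_capacity EE set0)).
    by apply: ereal_inf_lbound; exists set0 => //; split => //; exact: open0.
  apply: ereal_inf_lbound; exists (fun=> 0%R).
    split => //; exact: aeW.
  rewrite /form_plus /inner2.
  have -> : form EE (fun=> 0%R) (fun=> 0%R) = 0%R.
    have := form_lin (-1)%R d0 d0 d0.
    rewrite (_ : (fun x => (-1 * 0 + 0)%R) = (fun=> 0%R)); last first.
      by apply/funext => x; rewrite mulr0 addr0.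
    by rewrite mulN1r addNr.
  rewrite add0r mul1r.
  by under eq_Rintegral do rewrite mulr0; rewrite /Rintegral integral0.
apply: le_ereal_inf_tmp => _ [G _ <-]; apply: le_ereal_inf_tmp => _ [v [dv _] <-].
rewrite lee_fin addr_ge0// ?form_ge0// mul1r.
by apply: Rintegral_ge0 => x _; rewrite -expr2 sqr_ge0.
Qed.

(** This makes the family in [sup_exit] nonempty, so that its supremum is not [-oo] and inherits
    nonnegativity. *)
Lemma Oq_set0 : Oq X EE D set0.
Proof.
split => //.
- move=> e e0; exists set0; split => //; first exact: open0.
  by rewrite set0D capacity_set0.
- move=> mu; exists set0, set0; split => //; first by rewrite image_set0.
  exists set0; split => //.
    by under eq_integral do rewrite measure0; rewrite integral0.
  by move=> w [t _ []].
Qed.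

Lemma sup_exit_ge0 g : (forall y, 0 <= g y)%R -> 0 <= sup_exit X EE D rho g.
Proof.
move=> g0; apply: le_trans (ereal_sup_ubound _); last first.
  by exists set0; [exact: Oq_set0 | reflexivity].
apply: cintegral_ge0 => x Dx; rewrite mule_ge0 ?exit_op_ge0//.
by rewrite lee_fin ltW// rho0.
Qed.

End exit.

(** * A superlinear convex function built from hinges *)

Section hinge_sum.
Context {R : realType} (a : nat -> nat) (leka : forall k, (k <= a k)%N).
Implicit Types x y : R.

Let hinge k x : R := Num.max (x - (a k)%:R) 0.

(* As k <= a k, the terms with k >= x vanish: this is the series
   sum_k (x - a k)^+. *)
Definition hinge_sum x := \sum_(0 <= k < (Num.truncn x).+1) hinge k x.

Let hinge_ge0 k x : 0 <= hinge k x.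
Proof. by rewrite le_max lexx orbT. Qed.

Let hinge_eq0 k x : x <= k%:R -> hinge k x = 0.
Proof.
move=> xk; apply/max_r; rewrite subr_le0 (le_trans xk)// ler_nat.
exact: leka.
Qed.

Let hinge_tail x i j : x <= i%:R -> \sum_(i <= k < j) hinge k x = 0.
Proof.
move=> xi; rewrite big_nat big1// => k /andP[ik _].
by rewrite hinge_eq0// (le_trans xi)// ler_nat.
Qed.

(** Any integer bound of [x] can serve as cutoff, so several points can be handled with the same
    finite number of hinges. *)
Lemma hinge_sumE x n : x <= n%:R ->
  hinge_sum x = \sum_(0 <= k < n) Num.max (x - (a k)%:R) 0.
Proof.
move=> xn; have xt : x <= (Num.truncn x).+1%:R by exact/ltW/truncnS_gt.
wlog le : / (n <= (Num.truncn x).+1)%N; last first.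
  by rewrite /hinge_sum (big_cat_nat _ le)//= (hinge_tail _ xn) addr0.
have [?|/ltnW le _] := leqP n (Num.truncn x).+1; first exact.
by rewrite /hinge_sum [RHS](big_cat_nat _ le)//= (hinge_tail _ xt) addr0.
Qed.

Lemma hinge_sum_nneseries x :
  (hinge_sum x)%:E = (\sum_(k <oo) (Num.max (x - (a k)%:R) 0)%:E)%E.
Proof.
have xt : x <= (Num.truncn x).+1%:R by exact/ltW/truncnS_gt.
rewrite (nneseries_split 0 (Num.truncn x).+1); last first.
  by move=> k _; rewrite lee_fin hinge_ge0.
rewrite add0n sumEFin [X in (_ + X)%E]eseries0 ?adde0// => i ti _.
by congr EFin; apply: hinge_eq0; rewrite (le_trans xt)// ler_nat.
Qed.

Lemma hinge_sum_ge0 x : 0 <= hinge_sum x.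
Proof. exact: sumr_ge0. Qed.

Lemma hinge_sum0 : hinge_sum 0 = 0.
Proof. by rewrite (@hinge_sumE _ 0%N)// big_nil. Qed.

Let upper x y : exists n, x <= n%:R /\ y <= n%:R.
Proof.
exists (Num.truncn (Num.max x y)).+1.
by split; apply: (le_trans _ (ltW (truncnS_gt _))); rewrite le_max lexx ?orbT.
Qed.

Lemma le_hinge_sum : {homo hinge_sum : x y / x <= y}.
Proof.
move=> x y xy; have [n [xn yn]] := upper x y.
rewrite !(@hinge_sumE _ n)//; apply: ler_sum => k _.
by rewrite ge_max !le_max lerB// lexx orbT.
Qed.

(** Each hinge is convex, and a common bound [n] of [x] and [y] also bounds their convex
    combination. *)
Lemma convex_hinge_sum (A : set R) : convex_function (E := R^o) A hinge_sum.
Proof.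
move=> t x y _ _; have [n [xn yn]] := upper x y.
pose s : R := t%:num; have s0 : 0 <= s by rewrite /s.
have s1 : 0 <= 1 - s by rewrite subr_ge0 /s.
have convE (v w : R^o) : conv t v w = s * v + (1 - s) * w by [].
have cn : s * x + (1 - s) * y <= n%:R by nra.
rewrite !convE (hinge_sumE cn) (hinge_sumE xn) (hinge_sumE yn).
rewrite !mulr_sumr -big_split /=; apply: ler_sum => k _.
rewrite ge_max; apply/andP; split; last first.
  by apply: addr_ge0; apply: mulr_ge0 => //; exact: hinge_ge0.
have -> : s * x + (1 - s) * y - (a k)%:R =
  s * (x - (a k)%:R) + (1 - s) * (y - (a k)%:R) by ring.
by apply: lerD; apply: ler_wpM2l => //; rewrite le_max lexx.
Qed.

(** With [n >= A + 1] and [s] the sum of the first [n] values of [a], the first [n] hinges alone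
    give at least [n * x - s], hence at least [A * x] once [x >= s]. *)
Lemma hinge_sum_superlinear : hinge_sum x / x @[x --> +oo] --> +oo.
Proof.
apply/cvgryPge => A; have [n [An _]] := upper (A + 1) 0.
pose s : R := \sum_(0 <= k < n) (a k)%:R.
near=> x.
have x0 : 0 < x by near: x; apply: nbhs_pinfty_gt; exact: num_real.
have sx : s <= x by near: x; apply: nbhs_pinfty_ge; exact: num_real.
have [j [xj nj]] := upper x n%:R.
rewrite ler_pdivlMr// (hinge_sumE xj).
rewrite ler_nat in nj; rewrite (big_cat_nat _ nj)//=.
apply: (@le_trans _ _ (\sum_(0 <= k < n) (x - (a k)%:R))).
  rewrite sumrB sumr_const_nat subn0 -/s -mulr_natl; nra.
rewrite -[leLHS]addr0; apply: lerD; last first.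
  by apply: sumr_ge0 => k _; exact: hinge_ge0.
by apply: ler_sum => k _; rewrite le_max lexx.
Unshelve. all: by end_near. Qed.

End hinge_sum.

(** * Both directions of the equivalence *)

Theorem theorem4p5 (R : realType) (E : pmetricType R)
    (E_lc : locally_compact [set: E]) (E_sep : separable E)
    (m : {measure set (borel E) -> \bar R})
    (m_radon : radon m) (m_supp : full_support m)
    (EE : dirichlet_form m)
    (EE_reg : regular_form EE) (EE_trans : transient_form EE)
    (d : measure_display) (Omega : measurableType d)
    (X : hunt_process E Omega)
    (X_sym : symmetric_process X m) (X_EE : associated X EE)
    (D : set E) (D_open : open D) (D_nonempty : D !=set0)
    (D_ac : killed_absolutely_continuous X m D)
    (u : E -> R) (u_nb : nearly_borel_fun X u)
    (u_out : forall x, ~ D x -> u x = 0)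
    (u_qc : quasi_continuous_on EE D u)
    (rho : E -> R) (rho_Theta : Theta m D rho) :
  D1c X EE D rho u <->
  exists phi : R -> R,
    [/\ {in `[0, +oo[ &, {homo phi : x y / x <= y}},
        convex_function (E := R^o) [set x : R | 0 <= x] phi,
        forall x, 0 <= x -> 0 <= phi x,
        phi 0 = 0 /\ phi x / x @[x --> +oo] --> +oo &
        (sup_exit X EE D rho (fun x => phi `|u x|%R) < +oo)%E].
Proof.
have [_ rho0 _] := rho_Theta.
have normE n : D1_norm X EE D rho (fun x => Num.max (`|u x| - n%:R) 0) =
    sup_exit X EE D rho (fun x => Num.max (`|u x| - n%:R) 0).
  congr (sup_exit X EE D rho); apply/funext => x.
  by rewrite ger0_norm// le_max lexx orbT.
split=> [[[_ _ cvu] _]|[phi [_ _ phi_ge0 [_ phi_oo] phi_fin]]].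
  (* Both conditions hold for all large [n]: the bound makes the norms summable, and [k <= n] makes
     the hinge series locally finite. *)
  have /choice[a aP] k : exists n, (k <= n)%N /\
      (sup_exit X EE D rho (fun x => Num.max (`|u x| - n%:R)%R 0%R) <=
        (1 / (2 ^ k.+1)%:R)%:E)%E.
    have ek : 0 < 1 / (2 ^ k.+1)%:R :> R by rewrite divr_gt0// ltr0n expn_gt0.
    have [fin /cvgr_lt /(_ _ ek) lt] := (fine_cvgP _ _).1 cvu.
    near \oo => n; exists n; split; first by near: n; exact: nbhs_infty_ge.
    have nfin : D1_norm X EE D rho (fun x => Num.max (`|u x| - n%:R) 0)
      \is a fin_num by near: n.
    by rewrite -normE -(fineK nfin) lee_fin ltW//; near: n.
  have lea k : (k <= a k)%N by have [] := aP k.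
  exists (hinge_sum a); split.
  - by move=> x y _ _; exact: le_hinge_sum.
  - exact: convex_hinge_sum.
  - by move=> x _; exact: hinge_sum_ge0.
  - by split; [exact: hinge_sum0 | exact: hinge_sum_superlinear].
  apply: le_lt_trans (ltry 1%R).
  (* The bounds [1 / 2 ^ k.+1] sum to at most 1. *)
  apply: le_trans (epsilon_trick0 xpredT ler01).
  apply: (@le_trans _ _ (\sum_(k <oo)
      sup_exit X EE D rho (fun x => Num.max (`|u x| - (a k)%:R)%R 0%R))%E).
    apply: sup_exit_nneseries_le => // y.
    exact: hinge_sum_nneseries.
  apply: lee_nneseries => k _; last by have [] := aP k.
  by move=> _; apply: sup_exit_ge0 => // y; rewrite le_max lexx orbT.
split => //; split => //.
  (* [u] vanishes everywhere outside [D], so the exceptional set can be empty. *)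
  exists set0; first exact: capacity_set0.
  by move=> x _; exact: u_out.
have sup_ge0 n :
    (0 <= sup_exit X EE D rho (fun x => Num.max (`|u x| - n%:R)%R 0%R))%E.
  by apply: sup_exit_ge0 => // y; rewrite le_max lexx orbT.
have phi_sup0 : (0 <= sup_exit X EE D rho (fun x => phi `|u x|%R))%E.
  by apply: sup_exit_ge0 => // y; exact: phi_ge0.
pose c := fine (sup_exit X EE D rho (fun x => phi `|u x|%R)).
have cE : sup_exit X EE D rho (fun x => phi `|u x|%R) = c%:E.
  by rewrite fineK// ge0_fin_numE.
have c0 : 0 <= c by exact: fine_ge0.
have small e : 0 < e -> \forall n \near \oo,
    (sup_exit X EE D rho (fun x => Num.max (`|u x| - n%:R)%R 0%R) <= e%:E)%E.
  (* This [M] gives [c / M <= e]; the added 1 keeps [M] positive when [c = 0]. *)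
  move=> e0; pose M := (c + 1) / e.
  have M0 : 0 < M by rewrite divr_gt0// ltr_wpDl.
  have [t [_ tP]] := cvgry_ge phi_oo M.
  near=> n.
  have tn : t <= n%:R by near: n; exact: nbhs_infty_ger.
  apply: (@le_trans _ _
      (sup_exit X EE D rho (fun x => M^-1 * phi `|u x|%R)%R)).
    (* Where [|u y| <= n] the hinge vanishes; elsewhere [|u y|] exceeds the threshold [t], so
       [M * |u y| <= phi |u y|]. *)
    apply: le_sup_exit => // y; rewrite ge_max; apply/andP; split; last first.
      by rewrite mulr_ge0 ?phi_ge0// invr_ge0 ltW.
    have [un|nu] := leP `|u y| n%:R.
      apply: (@le_trans _ _ 0); first by rewrite subr_le0.
      by rewrite mulr_ge0 ?phi_ge0// invr_ge0 ltW.
    have u0 : 0 < `|u y| by rewrite (le_lt_trans _ nu).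
    have := tP _ (le_lt_trans tn nu); rewrite ler_pdivlMr// => Mphi.
    by rewrite ler_pdivlMl// (le_trans _ Mphi)// ler_pM2l// gerBl.
  have Mi0 : 0 < M^-1 by rewrite invr_gt0.
  have phiu0 y : 0 <= phi `|u y| by exact: phi_ge0.
  apply: (le_trans (sup_exitZl_le X EE D_open rho0 Mi0 phiu0)).
  rewrite cE -EFinM lee_fin ler_pdivrMl// /M divfK ?gt_eqF//.
  by rewrite lerDl.
(* Convergence in the extended reals: the norms are eventually finite, and their real values tend to
   0. *)
apply/fine_cvgP; split.
  near=> n; rewrite normE ge0_fin_numE// (@le_lt_trans _ _ 1%:E) ?ltry//.
  by near: n; exact: small.
apply/cvgrPdist_le => e e0; near=> n.
rewrite sub0r normrN /= normE ger0_norm ?fine_ge0//.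
have le : (sup_exit X EE D rho (fun x => Num.max (`|u x| - n%:R)%R 0%R)
  <= e%:E)%E by near: n; exact: small.
rewrite -lee_fin fineK// ge0_fin_numE//.
exact: le_lt_trans le (ltry _).
Unshelve. all: by end_near. Qed.
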